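(* Let $m$ be a positive integer and let $\rho$ be an integer with $2\le\rho\le m/2$. Then $$\mathbf{t}_\rho(\mathbb{Z}_m)=2\left\lfloor\frac{m-2}{2(\rho-1)}\right\rfloor+1$$ and $$\mathbf{s}_\rho(\mathbb{Z}_m)=\max\left\{\frac md\left(2\left\lfloor\frac{d-2}{2(\rho-1)}\right\rfloor+1\right): d\mid m,\ d\ge 2\rho\right\}.$$
   Context: Here $\mathbb{Z}_m=\mathbb{Z}/m\mathbb{Z}$. For a subset $A$ of a finite abelian group $G$ (written additively) put $A^\pm:=(-A)\cup\{0\}\cup A$, and for an integer $\rho\ge 0$ let $\langle A\rangle_\rho:=\{a_1+\dotsb+a_\rho: a_i\in A^\pm\}$ (with $\langle A\rangle_0=\{0\}$). The diameter of $G$ with respect to $A$ is $\operatorname{diam}_A(G):=\min\{\rho\ge 0:\langle A\rangle_\rho=G\}$, with $\min\varnothing=\infty$. The period of $S\subseteq G$ is the subgroup $\pi(S):=\{g\in G: S+g=S\}$; $S$ is aperiodic if $\pi(S)=\{0\}$. For a positive integer $\rho$, a subset $A\subseteq G$ is $\rho$-maximal if it is maximal under inclusion subject to $\operatorname{diam}_A(G)\ge\rho$ (i.e. subject to $\langle A\rangle_{\rho-1}\neq G$). Define, with the convention $\max\varnothing=0$, $$\mathbf{s}_\rho(G):=\max\{|A|: A\subseteq G,\ \rho\le\operatorname{diam}_A(G)<\infty\},$$ $$\mathbf{t}_\rho(G):=\max\{|A|: A \text{ is an aperiodic } \rho\text{-maximal subset of } G \text{ that generates } G\}.$$ *)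

(* Defs.v *)
From HB Require Import structures.
From mathcomp Require Import all_boot all_algebra all_fingroup.
From mathcomp Require boolp.

Set Implicit Arguments.
Unset Strict Implicit.
Unset Printing Implicit Defensive.

Import GRing.Theory.
Local Open Scope ring_scope.

Definition oppset (G : finZmodType) (A : {set G}) : {set G} :=
  [set - a | a in A].

(* A^\pm = (-A) \cup {0} \cup A *)
Definition symset (G : finZmodType) (A : {set G}) : {set G} :=
  oppset A :|: [set 0] :|: A.

(* The rho-fold sums a_1 + ... + a_rho with every a_i in A^\pm; this is {0}
   for rho = 0. *)
Definition ball (G : finZmodType) (A : {set G}) (rho : nat) : {set G} :=
  [set \sum_(i < rho) a i | a : {ffun 'I_rho -> G} in ffun_on [in symset A]].

(* The least rho with <A>_rho = G; None stands for infinity. *)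
Definition diam (G : finZmodType) (A : {set G}) : option nat :=
  match boolp.pselect (exists rho : nat, ball A rho == [set: G]) with
  | left ex => Some (ex_minn ex)
  | right _ => None
  end.

Definition diam_ge (G : finZmodType) (rho : nat) (A : {set G}) : bool :=
  if diam A is Some r then (rho <= r)%N else true.

Definition diam_finite (G : finZmodType) (A : {set G}) : bool :=
  diam A != None.

Definition period (G : finZmodType) (S : {set G}) : {set G} :=
  [set g : G | [set s + g | s in S] == S].

Definition aperiodic (G : finZmodType) (S : {set G}) : bool :=
  period S == [set 0].

Definition rho_maximal (G : finZmodType) (rho : nat) (A : {set G}) : bool :=
  maxset (diam_ge rho) A.

(* <<A>> is taken in the additive group of G. *)
Definition generates (G : finZmodType) (A : {set G}) : bool :=
  <<A>>%g == [set: G].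

(* \max over an empty family of naturals is 0. *)
Definition s_ (rho : nat) (G : finZmodType) : nat :=
  (\max_(A : {set G} | diam_ge rho A && diam_finite A) #|A|)%N.

Definition t_ (rho : nat) (G : finZmodType) : nat :=
  (\max_(A : {set G} | [&& aperiodic A, rho_maximal rho A & generates A]) #|A|)%N.

(* Main.v *)
Require Import Defs.
From mathcomp Require Import all_boot all_algebra all_fingroup all_solvable zify.
From mathcomp Require boolp.

(** Write h for rho - 1.  The condition diam_A(G) >= rho says that the h-fold
    sumset of the symmetrization of A is not G, so a rho-maximal set is a
    symmetric set A containing the neutral element and maximal subject to
    hA <> G.

    Upper bound.  By Kneser's theorem (lemma kneser, iterated in kneser_pow),
    |hA| >= h |A + H| - (h - 1) |H|, where H is the stabilizer of hA.  Since
    h(A + H) = hA, maximality gives A + H = A, so an aperiodic A satisfies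
    h (|A| - 1) + 1 <= |hA| <= |G| - 1.  If A contains no involution, inversion fixes
    only its neutral element, so |A| is odd, and the bound |A| <= 2 floor((|G| - 2) / 2h) + 1 follows.  If A
    contains the involution u of the cyclic group G, then |A|, |hA| and |G| are
    all even, and one needs |hA| >= h |A| - 1, which is stronger than Kneser's
    inequality as soon as h >= 3.  The gain (lemma involution_lower_bound)
    comes from splitting A into the part invariant under translation by u and
    the rest.

    Lower bound.  In Z_d the interval -k, ..., k with
    k = floor((d - 2) / 2h) has 2k + 1 elements, its h-fold sumset misses an
    element, and adding any further pair x, -x makes the h-fold sumset
    everything (lemma itv_maximal); it is aperiodic and generates Z_d.  This
    gives the value of t.

    For s, a set A of finite diameter at least rho extends to a rho-maximal
    one; dividing by its period P gives an aperiodic maximal subset of a cyclic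
    group of order d = m / |P|, to which the upper bound applies, and d >= 2 rho
    since otherwise that subset would be a single point.  Conversely the
    preimage in Z_m of an interval of Z_d has (m / d)(2k + 1) elements and
    has the right diameter.

    Sets are multiplied with the product of subsets of a finite group: for the
    additive group of a finite abelian group, A ^+ h is the h-fold sumset. *)

Set Implicit Arguments.
Unset Strict Implicit.
Unset Printing Implicit Defensive.
Import GRing.Theory.
Import GroupScope.

(** * Stabilizers and Kneser's theorem *)

Section Stabilizer.
Variable gT : finGroupType.
Implicit Types A B C X : {set gT}.

Definition stab A : {set gT} := [set g | A :* g == A].

Lemma group_set_stab A : group_set (stab A).
Proof.
apply/group_setP; split=> [|x y]; first by rewrite inE mulg1.
by rewrite !inE => /eqP xA /eqP yA; rewrite rcosetM xA yA.
Qed.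
Canonical stab_group A := Group (group_set_stab A).

Lemma mulg_stab A : A * stab A = A.
Proof.
apply/eqP; rewrite eqEsubset mulg_subl ?group1 // andbT.
apply/subsetP=> _ /mulsgP[a g aA gS ->].
by move: gS; rewrite inE => /eqP <-; rewrite mem_rcoset mulgK.
Qed.

Lemma sub_stab A (H : {group gT}) : (H \subset stab A) = (A * H \subset A).
Proof.
apply/idP/idP=> [sHA|sAH]; first by rewrite -{2}(mulg_stab A) mulgS.
apply/subsetP=> g gH; rewrite inE eqEcard card_rcoset leqnn andbT.
by apply: subset_trans sAH; rewrite mulgS ?sub1set.
Qed.

Lemma mulg_sub_stab A (H : {group gT}) : H \subset stab A -> A * H = A.
Proof.
by rewrite sub_stab => sAH; apply/eqP; rewrite eqEsubset sAH mulg_subl ?group1.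
Qed.

Hypothesis cGT : abelian [set: gT].

Lemma mulgC_abel (x y : gT) : x * y = y * x.
Proof. by apply: (centsP cGT); rewrite inE. Qed.

Lemma mulSC A B : A * B = B * A.
Proof.
apply: centC; apply: sub_abelian_cent2 cGT _ _; exact: subsetT.
Qed.

Lemma mulSAC A B C : A * B * C = A * C * B.
Proof. by rewrite -!mulgA (mulSC B). Qed.

Lemma mulSCA A B C : A * (B * C) = B * (A * C).
Proof. by rewrite !mulgA (mulSC A). Qed.

Lemma stabMr A B : stab B \subset stab (A * B).
Proof. by rewrite sub_stab -mulgA mulg_stab. Qed.

Lemma stabMl A B : stab A \subset stab (A * B).
Proof. by rewrite mulSC stabMr. Qed.

Lemma rcosetM_abel (H : {group gT}) a b : (H :* a) * (H :* b) = H :* (a * b).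
Proof.
rewrite rcoset_mul //; move: (in_setT a); apply/subsetP.
by rewrite cents_norm // (sub_abelian_cent2 cGT) ?subsetT.
Qed.

(** Passing from U * J to U * H fills up the cosets of H that U meets; it is
    enough to compare on a union V of some of these cosets. *)
Lemma card_mulS_subgroups (U V : {set gT}) (H J : {group gT}) :
  J \subset H -> V \subset U * H -> V * H = V ->
  #|U * J| + #|V| <= #|U * H| + #|(U :&: V) * J|.
Proof.
move=> sJH sVU VH.
have sub : (U * J) :|: V \subset U * H by rewrite subUset mulgS.
have subI : (U * J) :&: V \subset (U :&: V) * J.
  apply/subsetP=> x /setIP[/mulsgP[u j uU jJ ->] xV].
  apply: (mem_mulg _ jJ); rewrite inE uU -VH -(mulgK j u).
  by rewrite mem_mulg // groupV (subsetP sJH).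
by rewrite -(cardsUI (U * J)) leq_add ?subset_leq_card.
Qed.

(** The inequality of Kneser's theorem for one pair, which the induction below
    has to assume for pairs with a smaller product set. *)
Definition kneser_at A B :=
  A != set0 -> B != set0 -> #|A| + #|B| <= #|A * B| + #|stab (A * B)|.

(** Saturating A and B by the stabilizer of A * B leaves the product set
    unchanged, so the inequality improves by itself. *)
Lemma kneser_strong A B (K := stab (A * B)) :
  kneser_at (A * K) (B * K) -> A != set0 -> B != set0 ->
  #|A * K| + #|B * K| <= #|A * B| + #|K|.
Proof.
move=> kn A0 B0.
have E : (A * K) * (B * K) = A * B.
  by rewrite mulgA (mulSAC A) -mulgA mulGid mulg_stab.
have nz C : C != set0 -> C * K != set0.
  by apply: contraNneq => E0; rewrite -subset0 -E0 mulg_subl ?(group1 (stab_group _)).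
by have := kn (nz _ A0) (nz _ B0); rewrite E.
Qed.

(** DeVos's notion: a part C of A * B, invariant under H, that is large enough to
    yield Kneser's inequality if H fixes all of A * B. *)
Definition convergent A B C (H : {set gT}) :=
  [&& C != set0, C \subset A * B, C * H == C &
      #|A :&: B| + #|(A :|: B) * H| <= #|C| + #|H|].

(** If H does not stabilize A * B, some coset W of H, meeting A * B in a product
    a * b, is not contained in A * B and is therefore disjoint from C.  The
    products of the parts of A and B lying in the cosets of a and b fall in W;
    adding one or two of them to C, and using Kneser's inequality for these
    smaller product sets, produces a convergent set with a smaller subgroup. *)
Lemma convergent_refine A B C (H : {group gT}) :
  (forall A' B', #|A' * B'| < #|A * B| -> kneser_at A' B') ->
  convergent A B C H -> ~~ (H \subset stab (A * B)) ->
  exists (C' : {set gT}) (H' : {group gT}),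
    #|H'| < #|H| /\ convergent A B C' H'.
Proof.
move=> IH /and4P[C0 sCAB /eqP CH conv] nsH.
have [a [b [aA bB nsW]]] : exists a b, [/\ a \in A, b \in B &
    ~~ (H :* (a * b) \subset A * B)].
  move: nsH; rewrite sub_stab => /subsetPn[_ /mulsgP[_ x /mulsgP[a b aA bB ->] xH ->] nab].
  exists a, b; split=> //; apply/subsetPn; exists (a * b * x) => //.
  by rewrite mulgC_abel mem_rcoset mulgK.
pose W := H :* (a * b); pose U := A :|: B.
pose A1 := A :&: (H :* a); pose A2 := A :&: (H :* b).
pose B1 := B :&: (H :* b); pose B2 := B :&: (H :* a).
have dCW : [disjoint C & W].
  rewrite -setI_eq0; apply: contraNT nsW => /set0Pn[c /setIP[cC cW]].
  apply: subset_trans sCAB; rewrite /W -(rcoset_eqP cW) -CH mulSC.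
  by rewrite mulgS ?sub1set.
have smaller X : X \subset W -> X \subset A * B -> #|X| < #|A * B|.
  move=> sXW sXAB; have dCX : [disjoint C & X] by apply: disjointWr dCW.
  have /subset_leq_card : C :|: X \subset A * B by rewrite subUset sCAB.
  apply: leq_trans; move: dCX; rewrite -leq_card_setU => /eqP->.
  by rewrite -[X in X < _]add0n ltn_add2r card_gt0.
have sW1 : A1 * B1 \subset W by rewrite /W -rcosetM_abel mulgSS ?subsetIr.
have sW2 : A2 * B2 \subset W.
  by rewrite /W (mulgC_abel a) -rcosetM_abel mulgSS ?subsetIr.
have sAB1 : A1 * B1 \subset A * B by rewrite mulgSS ?subsetIl.
have sAB2 : A2 * B2 \subset A * B by rewrite mulgSS ?subsetIl.
have HW : H * W = W by rewrite /W mulgA mulGid.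
have A1n : a \in A1 by rewrite inE aA rcoset_refl.
have B1n : b \in B1 by rewrite inE bB rcoset_refl.
(* X fills only a part of the coset W, so its stabilizer is a proper subgroup. *)
have stab_proper X : X != set0 -> X \subset W -> X \subset A * B ->
    stab X \proper H.
  move=> /set0Pn[x xX] sXW sXAB; rewrite properE; apply/andP; split.
    apply/subsetP=> g gX; have: x * g \in W.
      by apply: (subsetP sXW); rewrite -(mulg_stab X) mem_mulg.
    have /rcosetP[k kH ->] := subsetP sXW _ xX.
    by rewrite -mulgA (mulgC_abel (a * b)) mulgA mem_rcoset mulgK groupMl.
  apply: contra nsW; rewrite sub_stab => sXH; rewrite -/W.
  apply: subset_trans sXAB; apply: subset_trans sXH.
  rewrite /W -(rcoset_eqP (subsetP sXW _ xX)) (mulSC X).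
  by rewrite mulgS ?sub1set.
have strong (X Y : {set gT}) : X * Y \subset W -> X * Y \subset A * B -> X != set0 -> Y != set0 ->
    #|X * stab (X * Y)| + #|Y * stab (X * Y)| <= #|X * Y| + #|stab (X * Y)|.
  move=> sXYW sXYAB X0 Y0; apply: kneser_strong => //; apply: IH.
  rewrite mulgA (mulSAC X) -mulgA mulGid mulg_stab.
  exact: smaller.
have A10 : A1 != set0 by apply/set0Pn; exists a.
have B10 : B1 != set0 by apply/set0Pn; exists b.
have kn1 := strong _ _ sW1 sAB1 A10 B10.
have sU g : g \in U -> H :* g \subset U * H.
  by move=> gU; rewrite mulSC mulgS ?sub1set.
have aU : a \in U by rewrite inE aA.
have bU : b \in U by rewrite inE bB orbT.
(* A part X of W can be added to C, at the level of the smaller subgroup J, if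
   the loss in some union V of cosets of H is compensated by X and J. *)
have cW X (J : {group gT}) : J \subset H -> X \subset W -> X \subset A * B ->
    X * J = X -> forall V : {set gT}, V \subset U * H -> H * V = V ->
    #|(U :&: V) * J| + #|H| <= #|X| + #|J| + #|V| ->
    convergent A B (C :|: X) J.
  move=> sJH sXW sXAB XJ V sVU HV bound; apply/and4P; split.
  - by case/set0Pn: C0 => c cC; apply/set0Pn; exists c; rewrite inE cC.
  - by rewrite subUset sCAB.
  - by rewrite mulUg XJ mulg_sub_stab // (subset_trans sJH) // sub_stab CH.
  have := card_mulS_subgroups sJH sVU _; rewrite mulSC HV => /(_ erefl) cV.
  have dCX : [disjoint C & X] by apply: disjointWr dCW.
  move: dCX; rewrite -leq_card_setU => /eqP->.
  move: conv cV bound; rewrite -/U; clear.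
  move: #|A :&: B| #|U * H| #|U * J| #|C| #|H| #|V| #|(U :&: V) * J| #|X| #|J|.
  lia.
have A1B1n : A1 * B1 != set0 by apply/set0Pn; exists (a * b); rewrite mem_mulg.
(* A single coset suffices when it meets A and B only in A1 and B1. *)
have one_coset g : g \in U -> U :&: (H :* g) \subset A1 :|: B1 ->
  exists (C' : {set gT}) (H' : {group gT}),
    #|H'| < #|H| /\ convergent A B C' H'.
  move=> gU sg; exists (C :|: A1 * B1), (stab_group (A1 * B1)).
  have pH := stab_proper _ A1B1n sW1 sAB1.
  split; first exact: proper_card.
  apply: (cW _ _ (proper_sub pH)) (sU _ gU) _ _ => //.
  - exact: mulg_stab.
  - by rewrite mulgA mulGid.
  rewrite card_rcoset leq_add2r; apply: leq_trans kn1.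
  apply: leq_trans (leq_card_setU _ _); rewrite -mulUg.
  by rewrite subset_leq_card ?mulSg.
have UI g : U :&: (H :* g) = (A :&: (H :* g)) :|: (B :&: (H :* g)).
  by rewrite setIUl.
(* Unless A and B both meet two distinct cosets, A1 * B1 alone does. *)
have [B20|B20] := eqVneq B2 set0.
  by apply: (one_coset a) => //; rewrite UI -/A1 -/B2 B20 setU0 subsetUl.
have [A20|A20] := eqVneq A2 set0.
  by apply: (one_coset b) => //; rewrite UI -/A2 A20 set0U subsetUr.
have [Hab|nHab] := eqVneq (H :* a) (H :* b).
  by apply: (one_coset a) => //; rewrite UI {2}Hab.
have kn2 := strong _ _ sW2 sAB2 A20 B20.
have A2B2n : A2 * B2 != set0.
  by case/set0Pn: A20 => x xA; case/set0Pn: B20 => y yB;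
     apply/set0Pn; exists (x * y); rewrite mem_mulg.
have p1 := stab_proper _ A1B1n sW1 sAB1.
have p2 := stab_proper _ A2B2n sW2 sAB2.
set H1 := stab_group (A1 * B1); set H2 := stab_group (A2 * B2).
rewrite -/H1 -/H2 /= in p1 p2 kn1 kn2.
exists (C :|: (A1 * B1 :|: A2 * B2)), (H1 :&: H2)%G; split.
  exact: leq_ltn_trans (subset_leq_card (subsetIl _ _)) (proper_card p1).
apply: (cW _ _ _ _ _ _ (H :* a :|: H :* b)).
- exact: subset_trans (subsetIl _ _) (proper_sub p1).
- by rewrite subUset sW1.
- by rewrite subUset sAB1.
- by rewrite mulUg !mulg_sub_stab ?subsetIl ?subsetIr.
- by rewrite subUset !sU.
- by rewrite mulgU !mulgA mulGid.
have cHab : #|H :* a :|: H :* b| = #|H| + #|H|.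
  transitivity (#|H :* a| + #|H :* b|); last by rewrite !card_rcoset.
  apply/eqP; rewrite leq_card_setU.
  rewrite -setI_eq0; apply: contraNT nHab => /set0Pn[x /setIP[xa xb]].
  by rewrite -(rcoset_eqP xa) (rcoset_eqP xb).
have cUV : #|(U :&: (H :* a :|: H :* b)) * (H1 :&: H2)| <=
   #|A1 * B1| + #|H1| + (#|A2 * B2| + #|H2|).
  have : (U :&: (H :* a :|: H :* b)) * (H1 :&: H2) \subset
     (A1 * H1 :|: B1 * H1) :|: (A2 * H2 :|: B2 * H2).
    rewrite setIUr !UI -/A1 -/A2 -/B1 -/B2 !mulUg !subUset.
    apply/andP; split; apply/andP; split; apply/subsetP=> _ /mulsgP[x y xX /setIP[y1 y2] ->].
    - by rewrite !inE mem_mulg.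
    - by rewrite !inE (mem_mulg xX y2) !orbT.
    - by rewrite !inE (mem_mulg xX y2) !orbT.
    - by rewrite !inE (mem_mulg xX y1) !orbT.
  move/subset_leq_card/leq_trans; apply; apply: leq_trans (leq_card_setU _ _) _.
  by apply: leq_add; [apply: leq_trans kn1 | apply: leq_trans kn2]; exact: leq_card_setU.
(* Both A1 * B1 and A2 * B2 leave out a full coset of their stabilizers inside
   W, and two such cosets meet in at most #|H1 :&: H2| points. *)
have cI : #|(A1 * B1) :&: (A2 * B2)| + (#|H1| + #|H2|) <= #|H1 :&: H2| + #|H|.
  have avoid X : X \subset W -> X \subset A * B -> exists2 w, w \in W &
      [disjoint X & w *: stab X].
    move=> sXW sXAB; have /subsetPn[w wW wX] : ~~ (W \subset X).
      by apply: contra nsW => /subset_trans->.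
    exists w => //; rewrite -setI_eq0; apply: contraNT wX => /set0Pn[x /setIP[xX]].
    rewrite mem_lcoset => xS; rewrite -(mulg_stab X) -(mulKVg x w) mem_mulg //.
    by rewrite -groupV invMg invgK.
  have [w1 w1W d1] := avoid _ sW1 sAB1; have [w2 w2W d2] := avoid _ sW2 sAB2.
  have cDI : #|w1 *: H1 :&: w2 *: H2| <= #|H1 :&: H2|.
    have [->|/set0Pn[x /setIP[x1 x2]]] := eqVneq (w1 *: H1 :&: w2 *: H2) set0.
      by rewrite cards0.
    rewrite -(lcoset_eqP x1) -(lcoset_eqP x2) -(card_lcoset (H1 :&: H2) x) subset_leq_card //.
    by apply/subsetP=> y; rewrite in_setI !mem_lcoset in_setI.
  have sDW : w1 *: H1 :|: w2 *: H2 \subset W.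
    have sub w (K : {group gT}) : w \in W -> K \subset H -> w *: K \subset W.
      by move=> wW sK; rewrite (mulSC [set w]) -HW mulgSS ?sub1set.
    by rewrite subUset !sub ?proper_sub.
  have dCD : [disjoint (A1 * B1) :&: (A2 * B2) & w1 *: H1 :|: w2 *: H2].
    rewrite -setI_eq0 setIUr setU_eq0 !setI_eq0.
    by rewrite (disjointWl (subsetIl _ _) d1) (disjointWl (subsetIr _ _) d2).
  have : #|A1 * B1 :&: A2 * B2| + #|w1 *: H1 :|: w2 *: H2| <= #|H|.
    move: dCD; rewrite -leq_card_setU => /eqP<-.
    rewrite -(card_rcoset H (a * b)); apply: subset_leq_card.
    by rewrite subUset sDW (subset_trans (subsetIl _ _)).
  have := cardsUI (w1 *: H1) (w2 *: H2); rewrite !card_lcoset; move: cDI; clear.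
  move: #|A1 * B1 :&: _| #|w1 *: H1 :|: _| #|w1 *: H1 :&: _| #|H1 :&: H2|.
  move: #|H1| #|H2| #|H|; lia.
move: cUV cI; rewrite cHab; have := cardsUI (A1 * B1) (A2 * B2).
move: #|A1 * B1 :|: A2 * B2| #|A1 * B1 :&: A2 * B2| #|_ * (H1 :&: H2)|.
move: #|H1 :&: H2| #|A1 * B1| #|A2 * B2| #|H1| #|H2| #|H|; clear.
by move=> *; lia.
Qed.

(** The pair (A :&: B, A :|: B) has a product set inside A * B, and a smaller first
    component; by induction it provides a convergent set to start from, and a
    convergent set with minimal subgroup H must have H stabilizing A * B. *)
Lemma kneser_overlap A B : A :&: B != set0 ->
  (forall A' B', #|A' * B'| < #|A * B| -> kneser_at A' B') ->
  (forall B', #|(A :&: B) * B'| <= #|A * B| -> kneser_at (A :&: B) B') ->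
  #|A| + #|B| <= #|A * B| + #|stab (A * B)|.
Proof.
move=> AB0 IH IHI; pose U := A :|: B.
have U0 : U != set0.
  by case/set0Pn: AB0 => x /setIP[xA _]; apply/set0Pn; exists x; rewrite inE xA.
have sIU : (A :&: B) * U \subset A * B.
  by rewrite mulgU subUset {1}mulSC !mulgSS ?subsetIl ?subsetIr.
suff [C [H [conv sH]]] : exists C (H : {group gT}),
    convergent A B C H /\ H \subset stab (A * B).
  case/and4P: conv => _ sC _ cC; rewrite -(cardsUI A B) [X in X <= _]addnC.
  have leU : #|U| <= #|U * H| by rewrite subset_leq_card ?mulg_subl ?group1.
  apply: leq_trans (leq_add (leqnn _) leU) (leq_trans cC _).
  by rewrite leq_add ?subset_leq_card.
have : exists C (H : {group gT}), convergent A B C H.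
  pose C := (A :&: B) * U; exists C, (stab_group C); apply/and4P; split => //.
  - case/set0Pn: AB0 => x xI; case/set0Pn: U0 => y yU.
    by apply/set0Pn; exists (x * y); rewrite mem_mulg.
  - by rewrite mulg_stab.
  have E : (A :&: B) * (U * stab C) = C by rewrite mulgA mulg_stab.
  have := IHI (U * stab C); rewrite /kneser_at E; apply=> //.
    exact: subset_leq_card.
  by apply: contraNneq U0 => E0; rewrite -subset0 -E0 mulg_subl ?(group1 (stab_group _)).
case=> C [H]; have [n] := ubnP #|H|; elim: n C H => // n IHn C H ltn conv.
have [sH|nsH] := boolP (H \subset stab (A * B)); first by exists C, H.
have [C' [H' [ltH conv']]] := convergent_refine IH conv nsH.
by apply: IHn conv'; apply: leq_trans ltH _.
Qed.

(** Kneser's theorem.  Unless A lies in one coset of the stabilizer, B can be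
    translated so that it meets A without containing it. *)
Lemma kneser A B : A != set0 -> B != set0 ->
  #|A| + #|B| <= #|A * B| + #|stab (A * B)|.
Proof.
have [n] := ubnP #|A * B|; elim: n A B => // n IHn A B.
have [k] := ubnP #|A|; elim: k A B => // k IHk A B ltA ltAB A0 B0.
have overlap (A' B' : {set gT}) : #|A' * B'| <= #|A * B| -> #|A'| <= #|A| ->
    A' :&: B' != set0 -> ~~ (A' \subset B') ->
    #|A'| + #|B'| <= #|A' * B'| + #|stab (A' * B')|.
  move=> leAB leA AB0 nAB; apply: kneser_overlap => // [A1 B1 lt1|B1 le1].
    by apply: IHn; apply: leq_trans lt1 _; apply: leq_trans leAB _.
  apply: IHk; last by apply: leq_ltn_trans ltAB; apply: leq_trans leAB.
  apply: leq_trans (leq_trans leA ltA); apply: proper_card.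
  by rewrite properE subsetIl subsetI subxx.
have [a aA] := set0Pn _ A0; have [sA|nsA] := boolP (A \subset stab (A * B) :* a).
  rewrite addnC leq_add //; last by have := subset_leq_card sA; rewrite card_rcoset.
  by rewrite -(card_lcoset B a) subset_leq_card // mulSg ?sub1set.
have [a' a'A na'] := subsetPn nsA.
have [b bB nb] : exists2 b, b \in B & a' * a^-1 * b \notin B.
  have [sB|/subsetPn[x]] := boolP (B :* (a' * a^-1) \subset B).
    case/negP: na'; rewrite mem_rcoset (subsetP (stabMr A B)) // inE.
    by rewrite eqEcard sB card_rcoset /=.
  rewrite mem_rcoset => xB nx; exists (x * (a' * a^-1)^-1) => //.
  by rewrite mulgC_abel mulgKV.
pose B' := B :* (b^-1 * a).
have AB' : A * B' = (A * B) :* (b^-1 * a) by rewrite mulgA.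
have stabE C g : stab (C :* g) = stab C.
  apply/setP=> x; rewrite !inE mulSAC.
  by rewrite (can_eq (rcosetK g)).
have := overlap A B'; rewrite AB' stabE !card_rcoset; apply => //.
  apply/set0Pn; exists a; rewrite inE aA mem_rcoset invMg invgK mulKVg.
  by rewrite bB.
apply/subsetPn; exists a' => //; rewrite mem_rcoset invMg invgK.
by rewrite mulgA.
Qed.

End Stabilizer.

(** * Powers of a set *)

Section PowerSets.
Variable gT : finGroupType.
Hypothesis cGT : abelian [set: gT].
Implicit Types A B C X Y : {set gT}.

Lemma leq_cardU_disjoint A B C :
  [disjoint A & B] -> A \subset C -> B \subset C -> #|A| + #|B| <= #|C|.
Proof.
rewrite -leq_card_setU => /eqP<- sA sB.
by rewrite subset_leq_card // subUset sA.
Qed.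

(** The stabilizer K of the full product stabilizes every partial product
    saturated by K, so Kneser's inequality adds up along the factors. *)
Lemma kneser_pow X A j (K := stab (X * A ^+ j)) : X != set0 -> A != set0 ->
  #|X * K| + j * #|A * K| <= #|X * A ^+ j| + j * #|K|.
Proof.
rewrite {}/K; elim: j X => [|j IHj] X X0 A0.
  by rewrite !expg0 mulg1 mulg_stab !mul0n.
rewrite expgS mulgA; pose KG := stab_group (X * A * A ^+ j); set K := stab _.
have nz (B C : {set gT}) : B != set0 -> C != set0 -> B * C != set0.
  by case/set0Pn=> b bB /set0Pn[c cC]; apply/set0Pn; exists (b * c); rewrite mem_mulg.
have K0 : (K : {set gT}) != set0 by apply/set0Pn; exists 1; rewrite group1.
have IH := IHj (X * A) (nz _ _ X0 A0) A0; rewrite -/K in IH.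
have E : (X * K) * (A * K) = X * A * K.
  by rewrite mulgA (mulSAC cGT X K) -(mulgA (X * A)) (mulGid KG).
have := kneser cGT (nz _ _ X0 K0) (nz _ _ A0 K0); rewrite E.
have -> : stab (X * A * K) = K.
  apply/eqP; rewrite eqEsubset; apply/andP; split.
    have {2}-> : K = stab (X * A * K * A ^+ j).
      by rewrite (mulSAC cGT (X * A)) mulg_stab.
    exact: stabMl.
  by apply: subset_trans (stabMr _ _); rewrite (sub_stab _ KG) (mulGid KG).
rewrite !mulSn; move: IH; rewrite -/K.
move: #|X * A * K| #|X * A * A ^+ j| (muln j #|A * K|) (muln j #|K|) #|X * K| #|A * K| #|K|.
by clear=> *; lia.
Qed.

Lemma expgS_sub A i j : 1 \in A -> i <= j -> A ^+ i \subset A ^+ j.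
Proof.
move=> A1 /subnKC<-; elim: (j - i) => [|k IHk]; first by rewrite addn0.
by rewrite addnS expgS; apply: subset_trans IHk _; rewrite mulg_subr.
Qed.

Lemma expgS_mono A B j : A \subset B -> A ^+ j \subset B ^+ j.
Proof. by move=> sAB; elim: j => // j IHj; rewrite !expgS mulgSS. Qed.

Lemma expgS_group (H : {group gT}) j : 0 < j -> (H : {set gT}) ^+ j = H.
Proof.
case: j => // j _; elim: j => [|j IHj]; first by rewrite expg1.
by rewrite expgS IHj mulGid.
Qed.

Lemma expgS_mulg A B j : (A * B) ^+ j = A ^+ j * B ^+ j.
Proof. by apply: expgMn; apply: mulSC cGT _ _. Qed.

Lemma expgS_inv A j : (A ^+ j)^-1 = A^-1 ^+ j.
Proof.
elim: j => [|j IHj]; first by rewrite !expg0 invg1.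
by rewrite expgS expgSr invMg IHj.
Qed.

(** The maximality of rho-maximal sets for rho = h + 1, tested on symmetric sets
    only. *)
Definition sym_maximal h A :=
  [/\ A^-1 = A, 1 \in A, A ^+ h != [set: gT] &
    forall B, A \subset B -> B^-1 = B -> B ^+ h != [set: gT] -> B = A].

(** Saturating A by the stabilizer of A ^+ h does not change A ^+ h, hence, by
    maximality, does not change A. *)
Lemma stab_pow_sym_maximal h A : 0 < h -> sym_maximal h A ->
  stab (A ^+ h) \subset stab A.
Proof.
move=> h0 [AV A1 AhT maxA]; set H := stab_group (A ^+ h).
rewrite (sub_stab _ H) (maxA (A * H)) // ?mulg_subl ?group1 //.
  by rewrite invMg invGid AV mulSC.
by rewrite expgS_mulg expgS_group // mulg_stab.
Qed.

End PowerSets.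

(** * Maximal sets containing an involution *)

(** Translation by u splits A into an invariant part A0 and a part A1 disjoint
    from its translate.  Products with a factor in A0 form S, whose stabilizer L
    contains u; hence A1 has at most half of the elements of each coset of L. *)
Section Involution.
Variable gT : finGroupType.
Hypothesis cGT : abelian [set: gT].
Variables (A : {set gT}) (n : nat) (u : gT).
Hypothesis n2 : 2 <= n.
Hypothesis maxA : sym_maximal n.+1 A.
Hypothesis stabA : stab A = 1.
Hypothesis uA : u \in A.
Hypothesis u1 : u != 1.
Hypothesis u2 : u * u = 1.

Let A0 := [set a in A | a * u \in A].
Let A1 := A :\: A0.
Let S := A0 * A ^+ n.
Let L := stab_group S.

Let AV : A^-1 = A. Proof. by case: maxA. Qed.
Let A_1 : 1 \in A. Proof. by case: maxA. Qed.
Let uV : u^-1 = u. Proof. by rewrite -[LHS]mulg1 -u2 mulKg. Qed.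
Let inAV a : (a^-1 \in A) = (a \in A). Proof. by rewrite -mem_invg AV. Qed.
Let A0V : A0^-1 = A0.
Proof.
apply/setP=> a; rewrite mem_invg !inE inAV -{1}uV -invMg inAV.
by rewrite (mulgC_abel cGT).
Qed.
Let A1V : A1^-1 = A1.
Proof. by apply/setP=> a; rewrite mem_invg !in_setD inAV -{1}A0V mem_invg invgK. Qed.
Let A0_1 : 1 \in A0. Proof. by rewrite inE A_1 mul1g. Qed.
Let sA0 : A0 \subset A. Proof. by apply/subsetP=> a; rewrite inE => /andP[]. Qed.
Let sA1 : A1 \subset A. Proof. exact: subsetDl. Qed.
Let sS : S \subset A ^+ n.+1. Proof. by rewrite expgS mulSg. Qed.
Let uL : u \in L.
Proof.
apply: (subsetP (stabMl cGT A0 _)); rewrite inE eqEcard card_rcoset leqnn andbT.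
apply/subsetP=> a; rewrite mem_rcoset uV !inE -mulgA u2 mulg1 andbC //.
Qed.

(* By maximality, A absorbs A0 * L, since (A :|: A0 * L) ^+ n.+1 = A ^+ n.+1. *)
Let A0L : A0 * L = A0.
Proof.
have sub : A0 * L \subset A.
  pose B := A :|: A0 * L.
  suff -> : A = B by rewrite subsetUr.
  case: maxA => _ _ AhT max; rewrite [RHS]max ?subsetUl //.
    by rewrite /B invUg invMg invGid A0V AV (mulSC cGT L).
  apply: contra AhT; rewrite -!subTset => /subset_trans; apply.
  have pw j : B ^+ j.+1 \subset A ^+ j.+1 :|: A0 * L * A ^+ j.
    elim: j => [|j IHj]; first by rewrite !expg1 expg0 mulg1.
    rewrite expgS; apply: subset_trans (mulgS _ IHj) _.
    rewrite mulUg !mulgU !subUset -expgS subsetUl /=.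
    apply/and3P; split; apply: subset_trans (subsetUr _ _).
    - by rewrite (mulSCA cGT A) -expgS.
    - by rewrite subxx.
    rewrite !mulgA -(mulgA A0 L) (mulSC cGT L) !mulgA -(mulgA _ L L) mulGid.
    by rewrite expgS (mulgA _ A) (mulSAC cGT _ L A) !mulSg // mulgS.
  apply: subset_trans (pw n) _; rewrite subUset subxx /=.
  by rewrite (mulSAC cGT) -/S mulg_stab.
apply/eqP; rewrite eqEsubset mulg_subl ?group1 // andbT.
apply/subsetP=> x xA; rewrite inE (subsetP sub) //=.
by apply: (subsetP sub); rewrite -(mulGid L) mulgA mem_mulg.
Qed.

Let sLA0 : L \subset A0. Proof. by rewrite -A0L mulg_subr. Qed.

Let dA01 : [disjoint A0 & A1 * L].
Proof.
rewrite -setI_eq0; apply/set0Pn=> -[x /setIP[xA0 /mulsgP[a l aA1 lL xE]]].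
move: aA1; rewrite in_setD; case/andP=> /negP[].
by rewrite -A0L -(mulgK l a) -xE mem_mulg ?groupV.
Qed.

Let cardA : #|A| = #|A0| + #|A1|.
Proof. by rewrite -(cardsID A0) (setIidPr sA0). Qed.

Let cardAL : #|A0| + #|A1 * L| <= #|A * L|.
Proof. by apply: leq_cardU_disjoint => //; rewrite ?mulSg // -{1}A0L mulSg. Qed.

Let cardS : n.+1 * #|A0| + n * #|A1 * L| <= #|S| + n * #|L|.
Proof.
have nz (B : {set gT}) : 1 \in B -> B != set0 by move=> B1; apply/set0Pn; exists 1.
have := kneser_pow cGT n (nz _ A0_1) (nz _ A_1); rewrite -/S -[stab S]/(gval L) A0L.
move: cardAL; move: #|A * L| #|A1 * L| #|A0| #|S| #|L| (n).
by clear=> *; nia.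
Qed.

Let double (Y : {set gT}) : Y \subset A1 -> 2 * #|Y| <= #|Y * L|.
Proof.
move=> sY; rewrite mul2n -addnn -{2}(card_rcoset Y u).
apply: leq_cardU_disjoint; last 2 first.
- by rewrite mulg_subl ?group1.
- by rewrite mulgS ?sub1set.
rewrite -setI_eq0; apply/set0Pn=> -[x /setIP[xY]]; rewrite mem_rcoset uV => xuY.
have := subsetP sY _ xY; rewrite !inE => /andP[/negP[]].
by rewrite !(subsetP sA1) ?(subsetP sY).
Qed.

Let sAh : A ^+ n.+1 \subset S :|: A1 ^+ n.+1.
Proof.
rewrite /S; elim: n => [|j IHj].
  rewrite expg0 !expg1 mulg1; apply/subsetP=> a aA; rewrite in_setU in_setD aA andbT.
  exact: orbN.
have EA : A = A0 :|: A1 by rewrite -[LHS](setID A A0) (setIidPr sA0).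
rewrite expgS {1}EA mulUg subUset; apply/andP; split.
  by apply: subset_trans (subsetUl _ _).
apply: subset_trans (mulgS _ IHj) _.
rewrite mulgU -expgS setSU // (mulSCA cGT) mulgS // expgS mulSg //.
Qed.

Let AhS : A ^+ n.+1 != S.
Proof.
apply: contraNneq u1 => E; rewrite -in_set1 -[[set 1]]/(1 : {set gT}) -stabA.
by apply: (subsetP (stab_pow_sym_maximal cGT (ltn0Sn n) maxA)); rewrite E.
Qed.

(* Two factors with product in L can be traded for a factor in A0 and a neutral
   one. *)
Let pairS x y r : x * y \in L -> r \in A ^+ n.-1 -> x * y * r \in S.
Proof.
move=> xyL rA; apply: mem_mulg; first exact: (subsetP sLA0).
by apply: (subsetP _ _ rA); apply: expgS_sub A_1 _; exact: leq_pred.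
Qed.

Let disjoint_coset c (X : {set gT}) : c \notin S -> X \subset L :* c -> [disjoint S & X].
Proof.
move=> ncS sX; rewrite -setI_eq0; apply: contraNT ncS => /set0Pn[x /setIP[xS xX]].
rewrite -(mulg_stab S) (mulSC cGT); have := subsetP sX _ xX.
rewrite mem_rcoset -groupV invMg invgK => cxL.
by rewrite -(mulgKV x c) mem_mulg.
Qed.

Let disjoint_rcosets x y : x * y^-1 \notin L -> [disjoint L :* x & L :* y].
Proof.
move=> nxy; rewrite -setI_eq0; apply: contraNT nxy => /set0Pn[z /setIP[zx zy]].
by rewrite -mem_rcoset -(rcoset_eqP zy) (rcoset_eqP zx) rcoset_refl.
Qed.

Let sub_coset a : a \in A1 -> L :* a \subset A1 * L.
Proof. by move=> aA1; rewrite (mulSC cGT A1) mulgS ?sub1set. Qed.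

(** Kneser's inequality for S gives n.+1 |A0| + n (|A1 L| - |L|).  Since
    A ^+ n.+1 is aperiodic, it has an element c outside S, a product of
    elements of A1, no two of which multiply into L.  So A1 meets at least two
    cosets of L.  If it meets three or more, the elements of one coset, times
    the remaining factors of c, are enough new ones.  If it meets exactly two,
    these are inverse to each other, A1 = X :|: X^-1, and Kneser's theorem
    applies to X ^+ n.+1, which is disjoint from S. *)
Lemma involution_lower_bound : muln n.+1 #|A| <= #|A ^+ n.+1| + 1.
Proof.
have [c cAh ncS] : exists2 c, c \in A ^+ n.+1 & c \notin S.
  apply/subsetPn; apply: contra AhS => sub; rewrite eqEsubset sub; exact: sS.
have cA1 : c \in A1 ^+ n.+1.
  by have := subsetP sAh _ cAh; rewrite in_setU (negPf ncS).
have [k nE] : exists k, n = k.+2 by exists n.-2; rewrite -[LHS](subnKC n2) subn2.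
have : c \in A1 * (A1 * (A1 * A1 ^+ k)) by rewrite -!expgS -nE.
case/mulsgP=> a1 _ a1A /mulsgP[a2 _ a2A /mulsgP[a3 r a3A rA1 ->] ->] cE.
have rA : r \in A ^+ k by apply: (subsetP (expgS_mono _ sA1)).
have A1A x : x \in A1 -> x \in A by move/(subsetP sA1).
have n12 : a1 * a2 \notin L.
  apply: contra ncS => aL; rewrite cE mulgA pairS // nE /= expgS mem_mulg //.
  exact: A1A.
have n13 : a1 * a3 \notin L.
  apply: contra ncS => aL; rewrite cE (mulgA a2) (mulgC_abel cGT a2) -(mulgA a3) (mulgA a1).
  by rewrite pairS // nE /= expgS mem_mulg // A1A.
have n23 : a2 * a3 \notin L.
  apply: contra ncS => aL; rewrite cE (mulgA a2) (mulgA a1) (mulgC_abel cGT a1) -(mulgA (a2 * a3)).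
  by rewrite pairS // nE /= expgS mem_mulg // A1A.
have A1Vi x : (x^-1 \in A1) = (x \in A1) by rewrite -{1}A1V mem_invg invgK.
pose P := L :* a1; pose Q := L :* a2^-1.
have sPA : P \subset A1 * L by exact: sub_coset.
have sQA : Q \subset A1 * L by apply: sub_coset; rewrite A1Vi.
have dPQ : [disjoint P & Q] by apply: disjoint_rcosets; rewrite invgK.
have cP : #|P| = #|L| by rewrite card_rcoset.
have cQ : #|Q| = #|L| by rewrite card_rcoset.
have PL : P * L = P by rewrite /P (mulSAC cGT) mulGid.
pose X := A1 :&: P.
have zL : 2 * #|X| <= #|L|.
  rewrite -cP; apply: leq_trans (double (subsetIl _ _)) _.
  by rewrite -[X in _ <= X](congr1 (fun Y : {set gT} => #|Y|) PL) subset_leq_card // mulSg ?subsetIr.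
(* At least three cosets of L meet A1. *)
have [N3|N3] := leqP (3 * #|L|) #|A1 * L|.
  have extra : #|S| + #|X| <= #|A ^+ n.+1|.
    rewrite -(card_rcoset X (a2 * (a3 * r))); apply: leq_cardU_disjoint => //.
      apply: disjoint_coset ncS _; rewrite cE (rcosetM L a1) mulSg //; exact: subsetIr.
    rewrite expgS mulgSS //; first exact: subset_trans (subsetIl _ _) sA1.
    by rewrite sub1set nE !expgS !mem_mulg // A1A.
  have rest : 2 * #|A1 :\: P| + #|L| <= #|A1 * L|.
    apply: leq_trans (leq_add (double (subsetDl _ _)) (leqnn _)) _; rewrite -cP.
    apply: leq_cardU_disjoint => //; last by rewrite mulSg ?subsetDl.
    rewrite -setI_eq0; apply/set0Pn=> -[x /setIP[/mulsgP[y l]]].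
    rewrite in_setD => /andP[/negP nyP _] lL xE xP; apply: nyP.
    by rewrite -(mulgK l y) -xE -PL mem_mulg ?groupV.
  have := cardsID P A1; rewrite -/X => cA1'.
  move: cardS extra rest zL N3; rewrite cardA -cA1' nE; clear.
  move: #|A1 * L| #|A1 :\: P| #|A ^+ _| #|X| #|S| #|L| #|A0|.
  move=> N y t x s l a0 h1 h2 h3 h4 h5.
  have [M EM] : exists M, N = l + M by exists (N - l)%N; lia.
  move: h1 h2 h3 h4 h5; rewrite {}EM => h1 h2 h3 h4 h5.
  have k1 : (k.+3 * (2 * y) <= k.+3 * M)%N by rewrite leq_mul2l; lia.
  have k2 : (k.+1 * (4 * x) <= k.+1 * M)%N by rewrite leq_mul2l; lia.
  by have := leq0n (muln k x); lia.
(* Now A1 lies in the two cosets P and Q, and they are inverse to each other: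
   otherwise each is its own inverse, and two of the three factors a1, a2, a3
   lie in the same one. *)
have A1PQ a : a \in A1 -> (a \in P) || (a \in Q).
  move=> aA; apply: contraLR N3; rewrite negb_or -leqNgt => /andP[naP naQ].
  have sPQ : P :|: Q \subset A1 * L by rewrite subUset sPA.
  have : #|P :|: Q| + #|L :* a| <= #|A1 * L|.
    apply: leq_cardU_disjoint => //; last exact: sub_coset.
    rewrite -setI_eq0 setIUl setU_eq0 !setI_eq0 disjoint_sym disjoint_rcosets -?mem_rcoset //.
    by rewrite disjoint_sym disjoint_rcosets -?mem_rcoset.
  move: dPQ; rewrite -leq_card_setU => /eqP->; rewrite cP cQ card_rcoset.
  by rewrite mulSn mul2n -addnn addnA.
have a1VQ : a1^-1 \in Q.
  have := A1PQ a1^-1; rewrite A1Vi => /(_ a1A)/orP[|//]; rewrite mem_rcoset => a1a1.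
  have a1a1' : a1 * a1 \in L by rewrite -groupV invMg.
  have inQ b : b \in A1 -> a1 * b \notin L -> b \in Q.
    move=> bA nb; case/orP: (A1PQ b bA) => //; rewrite mem_rcoset => ba1.
    case/negP: nb; rewrite (mulgC_abel cGT) -(mulgKV a1 b) -mulgA.
    exact: groupM.
  have := inQ _ a2A n12; have := inQ _ a3A n13; rewrite !mem_rcoset !invgK => a32 _.
  by case/negP: n23; rewrite (mulgC_abel cGT).
have XV : X^-1 = A1 :&: Q.
  rewrite invIg A1V; congr (_ :&: _); rewrite invg_rcoset.
  by rewrite (mulSC cGT [set _]) (rcoset_eqP a1VQ).
have A1X : A1 = X :|: X^-1.
  rewrite XV -setIUr; apply/esym/setIidPl/subsetP=> a aA1.
  by rewrite in_setU A1PQ.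
have XXV : X * X^-1 \subset L.
  apply/subsetP=> _ /mulsgP[x y /setIP[_ xP] yX ->]; move: yX; rewrite mem_invg in_setI.
  case/andP=> _ yP; rewrite -[y]invgK -mem_rcoset.
  by rewrite (rcoset_eqP yP).
have sXA : X \subset A by apply: subset_trans (subsetIl _ _) sA1.
have sXVA : X^-1 \subset A by rewrite -AV invSg.
(* A product mixing X and X^-1 has a pair of factors with product in L. *)
have powA1 j : A1 ^+ j.+1 \subset A0 * A ^+ j :|: (X ^+ j.+1 :|: X^-1 ^+ j.+1).
  elim: j => [|j IHj]; first by rewrite !expg1 -A1X subsetUr.
  rewrite expgS; apply: subset_trans (mulgS _ IHj) _.
  have cross (Y : {set gT}) : Y \subset A -> Y * Y^-1 \subset L ->
     Y * (Y^-1) ^+ j.+1 \subset A0 * A ^+ j.+1.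
    move=> sY YY; rewrite expgS mulgA; apply: mulgSS.
      exact: subset_trans YY sLA0.
    apply: subset_trans (expgS_mono _ (_ : Y^-1 \subset A)) (expgS_sub A_1 (leqnSn j)).
    by rewrite -AV invSg.
  rewrite mulgU subUset; apply/andP; split.
    by apply: subset_trans (subsetUl _ _); rewrite (mulSCA cGT) mulgS // expgS mulSg.
  rewrite {1}A1X mulUg !mulgU -!expgS !subUset.
  have c1 := cross _ sXA XXV.
  have c2 : X^-1 * X ^+ j.+1 \subset A0 * A ^+ j.+1.
    by have := cross _ sXVA; rewrite invgK (mulSC cGT X^-1); apply.
  rewrite !(subset_trans c1 (subsetUl _ _)) !(subset_trans c2 (subsetUl _ _)) /= andbT.
  by rewrite (subset_trans (subsetUl _ _) (subsetUr _ _)) (subset_trans (subsetUr _ _) (subsetUr _ _)).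
pose XX := X ^+ n.+1.
have XXVE : X^-1 ^+ n.+1 = XX^-1 by rewrite /XX expgS_inv.
have AhE : A ^+ n.+1 = S :|: (XX :|: XX^-1).
  apply/eqP; rewrite eqEsubset !subUset sS -XXVE !expgS_mono //= andbT.
  apply: subset_trans sAh _; rewrite subUset subsetUl /=; exact: powA1.
have sXXP : XX \subset L :* (a1 ^+ n.+1).
  rewrite /XX; elim: (n) => [|j IHj]; first by rewrite !expg1 subsetIr.
  by rewrite expgS (expgS a1) -(rcosetM_abel cGT) mulgSS ?subsetIr.
have SV : S^-1 = S by rewrite invMg expgS_inv AV A0V (mulSC cGT).
have dSX : [disjoint S & XX].
  rewrite -setI_eq0; apply: contraNT AhS => /set0Pn[x /setIP[xS xX]].
  have sub : XX \subset S.
    have /rcoset_eqP E := subsetP sXXP _ xX.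
  apply: (subset_trans sXXP); rewrite -E.
    by rewrite (mulSC cGT) -(mulg_stab S) mulSg ?sub1set.
  by rewrite AhE; apply/eqP/setUidPl; rewrite subUset sub -SV invSg.
pose M := stab_group XX.
have a1X : a1 \in X by rewrite in_setI a1A rcoset_refl.
have a1XX : a1 ^+ n.+1 \in XX.
  rewrite /XX; elim: (n.+1) => [|j IHj]; first by rewrite !expg0 set11.
  by rewrite (expgS a1) expgS mem_mulg.
have sML : M \subset L.
  apply/subsetP=> g gM; have : a1 ^+ n.+1 * g \in XX by rewrite -(mulg_stab XX) mem_mulg.
  by move/(subsetP sXXP); rewrite (mulgC_abel cGT) mem_rcoset mulgK.
have M1 : (M : {set gT}) = 1.
  apply/trivgP; rewrite -stabA.
  apply: subset_trans (stab_pow_sym_maximal cGT (ltn0Sn n) maxA).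
  rewrite AhE sub_stab !mulUg (mulg_sub_stab sML) mulg_stab.
  by rewrite -{1}(invGid M) -invMg (mulSC cGT M) mulg_stab.
have knX : muln n.+1 #|X| <= #|XX| + n.
  have := kneser_pow cGT n.+1 (_ : 1 != set0) (_ : X != set0); rewrite !mul1g -/XX.
  rewrite -[stab XX]/(M : {set gT}) M1 mulg1 cards1 muln1.
  have -> : (1 : {set gT}) != set0 by apply/set0Pn; exists 1; rewrite set11.
  have -> : X != set0 by apply/set0Pn; exists a1.
  by move=> /(_ isT isT); rewrite add1n addnS.
have : #|S| + #|XX| <= #|A ^+ n.+1|.
  by apply: leq_cardU_disjoint => //; rewrite /XX expgS_mono.
have : #|L| + #|L| <= #|A1 * L| by rewrite -{1}cP -cQ leq_cardU_disjoint.
have : #|A1| <= #|X| + #|X| by rewrite {1}A1X -{2}(card_invg X) leq_card_setU.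
have : 0 < #|X| by rewrite card_gt0; apply/set0Pn; exists a1.
move: cardS zL knX n2; rewrite cardA; clear.
move: #|A1 * L| #|A ^+ _| #|A1| #|X| #|S| #|L| #|A0| #|XX|.
move=> N t b x s l a0 xx h1 h2 h3 n2 h4 h5 h6 h7.
have [y Ey] : exists y, x = y.+1 by exists x.-1; lia.
have [M EM] : exists M, N = (l + l + M)%N by exists (N - (l + l))%N; lia.
have [w Ew] : exists w, l = (2 * x + w)%N by exists (l - 2 * x)%N; lia.
subst N l x.
have k1 : (muln n.+1 b <= muln n.+1 (y.+1 + y.+1)) by rewrite leq_mul2l h5 orbT.
have k2 : 0 <= muln n M by []. have k3 : 0 <= muln n w by [].
have k4 : y <= muln n y by rewrite leq_pmull //; lia.
by lia.
Qed.

End Involution.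

(** * The upper bound for aperiodic maximal sets *)

Section UpperBound.
Variable gT : finGroupType.
Hypothesis cGT : abelian [set: gT].
Implicit Types A X : {set gT}.

(** Inversion pairs off the elements. *)
Lemma even_card_no_involution X :
  X^-1 = X -> (forall x, x \in X -> x * x != 1) -> ~~ odd #|X|.
Proof.
have [k] := ubnP #|X|; elim: k X => // k IHk X ltk XV nX.
have [->|/set0Pn[x xX]] := eqVneq X set0; first by rewrite cards0.
have xV : x^-1 \in X by rewrite -mem_invg XV.
have nxx : x^-1 != x.
  by apply: contraNneq (nX x xX) => E; rewrite -{2}E mulgV.
have cX : #|X| = #|X :\ x :\ x^-1|.+2.
  by rewrite (cardsD1 x X) xX (cardsD1 (x^-1) (X :\ x)) !inE nxx xV.
rewrite cX /= negbK; apply: IHk; first by rewrite cX in ltk; lia.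
  apply/setP=> y; rewrite mem_invg !inE -[y^-1 \in X]mem_invg XV.
  by rewrite (inj_eq (@invg_inj gT)) -(inj_eq (@invg_inj gT) y^-1) invgK andbCA.
by move=> y; rewrite !inE => /and3P[_ _ /nX].
Qed.

Lemma sym_maximal_kneser h A : 0 < h -> sym_maximal h A -> stab A = 1 ->
  muln h #|A| + 1 <= #|A ^+ h| + h.
Proof.
move=> h0 maxA sA; have [_ A1 _ _] := maxA.
have nz (B : {set gT}) : 1 \in B -> B != set0 by move=> B1; apply/set0Pn; exists 1.
have := kneser_pow cGT h (nz _ (set11 1)) (nz _ A1); rewrite !mul1g.
have -> : stab (A ^+ h) = 1.
  by apply/trivgP; rewrite -sA; apply: stab_pow_sym_maximal.
by rewrite mulg1 cards1 muln1 addnC.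
Qed.

Lemma odd_card_sym X : X^-1 = X -> 1 \in X ->
  (forall x, x \in X -> x * x = 1 -> x = 1) -> odd #|X|.
Proof.
move=> XV X1 nX; rewrite (cardsD1 1 X) X1 /= even_card_no_involution //.
  by rewrite invDg XV invg1.
move=> x; rewrite !inE => /andP[x1 xX]; apply: contraNneq x1 => E.
by apply/eqP/nX.
Qed.

Lemma even_card_sym X u : X^-1 = X -> 1 \in X -> u \in X -> u != 1 -> u * u = 1 ->
  (forall x, x * x = 1 -> x != 1 -> x = u) -> ~~ odd #|X|.
Proof.
move=> XV X1 uX u1 uu uniq; rewrite (cardsD1 u X) uX /= negbK odd_card_sym //.
- rewrite invDg XV; congr (_ :\: _); apply/setP=> x; rewrite mem_invg !inE.
  have uV : u^-1 = u by rewrite -[LHS]mulg1 -uu mulKg.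
  by rewrite -(inj_eq (@invg_inj gT)) invgK uV.
- by rewrite !inE X1 eq_sym u1.
move=> x; rewrite !inE => /andP[xu _] xx.
by apply/eqP; apply: contraNT xu => /(uniq _ xx) ->.
Qed.

(** Parity turns h (|A| - 1) + 2 <= |G| into the stated bound when |A| is odd.
    When A contains the involution, everything is even, and the sharper
    estimate h |A| <= |A ^+ h| + 1 improves by parity to h |A| <= |G| - 2; for
    h <= 2 it is a case of Kneser's inequality. *)
Lemma card_sym_maximal h A : 0 < h -> sym_maximal h A -> stab A = 1 ->
  (forall x y : gT, x * x = 1 -> y * y = 1 -> x != 1 -> y != 1 -> x = y) ->
  #|A| <= 2 * ((#|gT| - 2) %/ (2 * h)) + 1.
Proof.
move=> h0 maxA sA uniq; have kn := sym_maximal_kneser h0 maxA sA.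
have [AV A1 AhT _] := maxA.
have ltT : #|A ^+ h| < #|gT|.
  by rewrite -cardsT proper_card // properEneq AhT subsetT.
suff [j Aj jh] : exists2 j, #|A| <= muln 2 j + 1 & muln j (muln 2 h) <= #|gT| - 2.
  by apply: leq_trans Aj _; rewrite leq_add2r leq_mul2l /= leq_divRL ?muln_gt0.
have [/existsP[u /and3P[uA u1 /eqP uu]]|] :=
    boolP [exists u, [&& u \in A, u != 1 & u * u == 1]].
  have uniqu x : x * x = 1 -> x != 1 -> x = u by move=> xx x1; apply: uniq.
  have ev (X : {set gT}) : X^-1 = X -> 1 \in X -> u \in X -> ~~ odd #|X|.
    by move=> XV X1 uX; apply: even_card_sym uniqu.
  have eA := ev _ AV A1 uA.
  have eT : ~~ odd #|gT| by rewrite -cardsT ev ?inE // invGid.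
  have eAh : ~~ odd #|A ^+ h|.
    by apply: ev; rewrite ?expgS_inv ?AV //;
       apply: (subsetP (expgS_sub A1 h0)); rewrite expg1.
  have lb : muln h #|A| <= #|A ^+ h| + 1.
    have [h3|] := leqP 3 h; last by move: kn; lia.
    case: h h3 h0 maxA {kn AhT ltT eAh} => // n n2 _ maxA.
    exact: involution_lower_bound uA u1 uu.
  have [j Ej] : exists j, #|A| = muln 2 j by exists #|A|./2; lia.
  have eh : ~~ odd (muln h #|A|) by rewrite oddM (negPf eA) andbF.
  exists j; first by lia.
  have : muln h #|A| <= #|A ^+ h| by move: lb; lia.
  by rewrite Ej; move: ltT eT eAh; lia.
rewrite negb_exists => /forallP nu.
have oA : odd #|A|.
  apply: odd_card_sym => // x xA xx; apply/eqP.
  by have := nu x; rewrite xA xx eqxx andbT /= negbK.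
have [j Ej] : exists j, #|A| = muln 2 j + 1 by exists #|A|./2; lia.
exists j; first by rewrite Ej.
by move: kn ltT; rewrite Ej; lia.
Qed.

End UpperBound.

(** * Diameter and maximality in terms of powers *)

Section Balls.
Variable G : finZmodType.
Implicit Types A B : {set G}.

Lemma symsetE A : symset A = A^-1 :|: 1 :|: A.
Proof.
congr (_ :|: _ :|: _); apply/setP=> x; rewrite mem_invg.
apply/imsetP/idP=> [[a aA ->]|xA]; first by rewrite FinRing.zmodVgE GRing.opprK.
by exists x^-1 => //; rewrite FinRing.zmodVgE GRing.opprK.
Qed.

Lemma symset_inv A : (symset A)^-1 = symset A.
Proof. by rewrite symsetE !invUg invgK invg1 [LHS]setUC setUA setUAC. Qed.

Lemma symset_id A : A^-1 = A -> 1 \in A -> symset A = A.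
Proof.
move=> AV A1; rewrite symsetE AV; apply/setP=> x; rewrite !inE.
by case: (x =P 1) => [->|_]; rewrite ?A1 ?orbF ?orbb.
Qed.

Lemma sub_symset A : A \subset symset A.
Proof. exact: subsetUr. Qed.

Lemma symset1 A : 1 \in symset A.
Proof. by rewrite symsetE !inE eqxx orbT. Qed.

Lemma ballE A r : ball A r = symset A ^+ r.
Proof.
have -> : symset A ^+ r = \prod_(i < r) symset A.
  by rewrite big_const cardT size_enum_ord; elim: r => //= r <-; rewrite expgS.
apply/setP=> x; apply/imsetP/prodsgP=> [[a /ffun_onP aA ->]|[c cA ->]].
  by exists a => // i _; apply: aA.
exists [ffun i => c i]; first by apply/ffun_onP=> i; rewrite ffunE cA.
by apply: eq_bigr => i _; rewrite ffunE.
Qed.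

Lemma diam_geE A h : diam_ge h.+1 A = (symset A ^+ h != [set: G]).
Proof.
rewrite /diam_ge /diam; case: boolp.pselect => [ex|nex].
  case: ex_minnP => r /eqP; rewrite ballE => rT rmin; apply/idP/idP.
    by move=> hr; apply: contraTneq hr => hT; rewrite -leqNgt rmin // ballE hT.
  apply: contraNltn => rh; rewrite -subTset -rT.
  by apply: expgS_sub (symset1 A) _.
by apply/esym/negP => /eqP hT; apply: nex; exists h; rewrite ballE hT.
Qed.

Lemma diam_finiteP A :
  reflect (exists r, symset A ^+ r = [set: G]) (diam_finite A).
Proof.
rewrite /diam_finite /diam; case: boolp.pselect => [ex|nex] /=; constructor.
  by case: ex => r /eqP rT; exists r; rewrite -ballE.
by case=> r rT; apply: nex; exists r; rewrite ballE rT.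
Qed.

Lemma rho_maximal_sym h A : rho_maximal h.+1 A -> sym_maximal h A.
Proof.
move/maxsetP=> []; rewrite diam_geE => AhT max.
have AA : symset A = A.
  apply: max (sub_symset A); rewrite diam_geE.
  by rewrite (symset_id (symset_inv A) (symset1 A)).
have AV : A^-1 = A by rewrite -{1}AA symset_inv.
have A1 : 1 \in A by rewrite -AA symset1.
split=> //; first by rewrite -{1}AA.
move=> B sAB BV BhT; apply: max => //; rewrite diam_geE symset_id //.
exact: subsetP sAB _ A1.
Qed.

Lemma period_stab A : period A = stab A.
Proof. by apply/setP=> g; rewrite !inE -rcosetE. Qed.

End Balls.

(** * Transfer along a surjective morphism *)

Section Quotient.
Variables (gT rT : finGroupType) (D : {group gT}) (f : {morphism D >-> rT}).
Hypothesis cGT : abelian [set: gT].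
Hypothesis DT : D = [set: gT] :> {set gT}.
Hypothesis fT : f @* D = [set: rT].
Implicit Types (A : {set gT}) (B : {set rT}).

Lemma morphpre_expgS B r : 0 < r -> f @*^-1 (B ^+ r) = (f @*^-1 B) ^+ r.
Proof.
case: r => // r _; elim: r => [|r IHr]; first by rewrite !expg1.
by rewrite expgS morphpreMl ?fT ?subsetT // IHr -expgS.
Qed.

Lemma morphpre_eqT B : (f @*^-1 B == [set: gT]) = (B == [set: rT]).
Proof.
apply/eqP/eqP=> [E|->]; last by apply/setP=> x; rewrite !inE DT inE.
by rewrite -[B](@morphpreK _ _ _ f) ?fT ?subsetT // E -DT.
Qed.

Lemma card_morphpre_set B : #|f @*^-1 B| = (#|'ker f| * #|B|)%N.
Proof.
rewrite -sum1_card (partition_big f [in B]) /=; last by move=> x; rewrite !inE => /andP[].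
rewrite mulnC -sum_nat_const; apply: eq_bigr => y yB.
have /morphimP[x0 _ x0D yE] : y \in f @* D by rewrite fT inE.
rewrite -(card_rcoset _ x0) -sum1_card {}yE in yB *; apply: eq_bigl => x.
have xD : x \in D by rewrite DT inE.
apply/andP/idP => [[_ /eqP/(rcoset_kerP f xD x0D)//]|/(rcoset_kerP f xD x0D) E].
by rewrite !inE xD /= E yB.
Qed.

(** A set is the preimage of its image modulo its stabilizer, and preimages
    commute with powers, so maximality passes to the quotient, where the image
    has become aperiodic. *)
Lemma sym_maximal_morphim h A : 0 < h -> sym_maximal h A -> 'ker f = stab A ->
  [/\ sym_maximal h (f @* A), stab (f @* A) = 1 & #|A| = (#|'ker f| * #|f @* A|)%N].
Proof.
move=> h0 [AV A1 AhT max] kerE.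
have sAD (X : {set gT}) : X \subset D by rewrite DT subsetT.
have preA : f @*^-1 (f @* A) = A.
  by rewrite morphimK // kerE (mulSC cGT) mulg_stab.
split; last by rewrite -card_morphpre_set preA.
- split.
  + by rewrite -morphimV AV.
  + by rewrite -(morph1 f) mem_morphim.
  + by rewrite -morphpre_eqT morphpre_expgS // preA.
  move=> B sAB BV BhT; rewrite -[B](@morphpreK _ _ _ f) ?fT ?subsetT //.
  congr (_ @* _); apply: max.
  + by rewrite -preA morphpreS.
  + by rewrite -morphpreV BV.
  + by rewrite -morphpre_expgS // morphpre_eqT.
apply/trivgP/subsetP=> y; have /morphimP[x xD _ ->] : y \in f @* D by rewrite fT inE.
rewrite inE => /eqP E; rewrite !inE.
suff /(mem_morphim f xD) : x \in 'ker f.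
  by rewrite morphim_ker ?inE.
rewrite kerE inE eqEcard card_rcoset leqnn andbT.
apply/subsetP=> _ /rcosetP[a aA ->]; have aD := subsetP (sAD A) a aA.
rewrite -preA; apply/morphpreP; split; first exact: groupM.
by rewrite morphM // -E mem_rcoset mulgK mem_morphim.
Qed.

End Quotient.

Lemma cyclic_involution_uniq (gT : finGroupType) (x y : gT) :
  cyclic [set: gT] -> x * x = 1 -> y * y = 1 -> x != 1 -> y != 1 -> x = y.
Proof.
move=> cT xx yy x1 y1.
have ox : #[x] = 2 by rewrite (@nt_prime_order _ 2) // expgS expg1.
have oy : #[y] = 2 by rewrite (@nt_prime_order _ 2) // expgS expg1.
have /eqP E : <[x]> == <[y]> by rewrite (eq_subG_cyclic cT) ?subsetT // -!orderE ox oy.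
have : y \in <[x]> by rewrite E cycle_id.
by rewrite cycle2g // !inE (negPf y1) /= eq_sym => /eqP.
Qed.

(** * Intervals in the integers modulo n *)

Section Intervals.
Variable n : nat.
Definition Zint (z : int) : 'Z_n := (z%:~R)%R.
Arguments Zint z%_ring_scope.

Lemma ZintD x y : Zint (x + y)%R = Zint x * Zint y.
Proof. by rewrite /Zint intrD. Qed.

Lemma ZintN x : Zint (- x)%R = (Zint x)^-1.
Proof. by rewrite /Zint intrN. Qed.

Lemma ZintX x j : Zint (x *+ j)%R = Zint x ^+ j.
Proof. by elim: j => // j IHj; rewrite mulrS ZintD IHj expgS. Qed.

Definition itv (k : nat) : {set 'Z_n} :=
  [set Zint ((i : nat)%:Z - k%:Z)%R | i : 'I_((2 * k).+1)].

Lemma itvP x k : reflect (exists2 z : int, (`|z| <= k)%N & x = Zint z) (x \in itv k).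
Proof.
apply: (iffP imsetP) => [[i _ ->]|[z zk ->]].
  by exists ((i : nat)%:Z - k%:Z)%R => //; have := ltn_ord i; lia.
have lt : (`|(z + k%:Z)%R|%N < (2 * k).+1)%N by lia.
by exists (Ordinal lt) => //=; congr Zint; lia.
Qed.

Lemma itv_inv k : (itv k)^-1 = itv k.
Proof.
apply/setP=> x; rewrite mem_invg.
by apply/itvP/itvP=> -[z zk E]; exists (- z)%R; rewrite ?abszN // ZintN -E ?invgK.
Qed.

Lemma itv1 k : 1 \in itv k.
Proof. by apply/itvP; exists 0%R. Qed.

Lemma itv_expgS k h : itv k ^+ h = itv (h * k).
Proof.
elim: h => [|h IHh].
  rewrite expg0 mul0n; apply/setP=> x; rewrite inE; apply/eqP/itvP=> [->|[z]].
    by exists 0%R.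
  by rewrite leqn0 absz_eq0 => /eqP-> ->.
rewrite expgS IHh mulSn; apply/setP=> x; apply/mulsgP/itvP=> [[y w]|[z zk ->]].
  move=> /itvP[y' yk ->] /itvP[w' wk ->] ->; exists (y' + w')%R; first by lia.
  by rewrite ZintD.
have [z1 [z2 [le1 le2 zE]]] : exists z1 z2 : int,
    [/\ (`|z1| <= k)%N, (`|z2| <= h * k)%N & z = (z1 + z2)%R].
  have [le|lt] := leqP `|z|%N k; first by exists z, 0%R; split=> //; lia.
  have [z0|z0] := boolP (0 <= z)%R.
    by exists k%:Z%R, (z - k%:Z)%R; split; lia.
  by exists (- k%:Z)%R, (z + k%:Z)%R; split; lia.
exists (Zint z1) (Zint z2); first by apply/itvP; exists z1.
  by apply/itvP; exists z2.
by rewrite zE ZintD.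
Qed.

(** With D = X - k and E = Y - h k (d.+1 and e.+1 in the proof), the number of
    copies of X to use is j = ceil(E / D): then j X + (h - j) k = Y + s with
    s < D, and one must check that s <= 2 (h - j) k.  For j >= 2 this follows
    from (j - 1) D < E <= h, and for j = 1 from X <= n / 2. *)
Lemma interval_cover h k X Y : (0 < k)%N -> (k < X)%N -> (2 * X <= n)%N -> (2 * Y <= n)%N ->
  (n <= 2 * h * k.+1 + 1)%N -> (h * k < Y)%N ->
  exists2 j, (j <= h)%N & (j * X <= Y + (h - j) * k)%N /\ (Y <= j * X + (h - j) * k)%N.
Proof.
move=> k0 kX Xn Yn nh hY.
have [d dE] : exists d, X = (k + d.+1)%N by exists (X - k).-1; lia.
have [e eE] : exists e, Y = (h * k + e.+1)%N by exists (Y - h * k).-1; lia.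
have eh : (e.+1 <= h)%N by lia.
have := divn_eq e d.+1; have := ltn_pmod e (ltn0Sn d).
move: (e %/ d.+1) (e %% d.+1) => q s sd eq.
have [g hE] : exists g, h = (q.+1 + g)%N by exists (h - q.+1)%N; nia.
exists q.+1; first by lia.
subst h X Y; rewrite addKn {hY Yn}.
by case: q => [|q] in eq nh Xn eh *; split; nia.
Qed.

Hypothesis n1 : 1 < n.

Lemma Zint_eq1 z : (Zint z == 1) = (n %| `|z|%N).
Proof.
have nat_case k : ((k%:R : 'Z_n)%R == 0%R) = (n %| k).
  by rewrite -val_eqE /= val_Zp_nat.
case: z => k; first exact: nat_case.
by rewrite /Zint NegzE intrN -[1]/(0%R : 'Z_n) oppr_eq0 nat_case abszN.
Qed.

Lemma Zint_eq x y : (Zint x == Zint y) = (n %| `|(x - y)%R|)%N.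
Proof. by rewrite -Zint_eq1 ZintD ZintN -eq_mulgV1. Qed.

(** Every class has a representative of absolute value at most n / 2. *)
Lemma ZintP (x : 'Z_n) : exists2 z : int, (2 * `|z|%N <= n)%N & x = Zint z.
Proof.
have : x = Zint (x : nat)%:Z by rewrite /Zint -pmulrn natr_Zp.
have : (x < n)%N by rewrite -[X in (_ < X)%N](Zp_cast n1).
move: (nat_of_ord x) => v vn ->.
have [le|lt] := leqP (2 * v) n; first by exists v%:Z%R.
exists (v%:Z - n%:Z)%R; first by lia.
apply/eqP; rewrite Zint_eq.
by rewrite (_ : `|_|%N = n) ?dvdnn // opprB addrCA subrr addr0.
Qed.

Lemma card_itv k : ((2 * k).+1 <= n)%N -> #|itv k| = (2 * k).+1.
Proof.
move=> kn; rewrite card_imset ?card_ord // => i j /eqP; rewrite Zint_eq => d.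
apply/val_inj/eqP; apply: contraTT d => nij; rewrite /= in nij.
have := ltn_ord i; have := ltn_ord j => lj li.
by rewrite gtnNdvd //; lia.
Qed.

(** The residues of absolute value at most n - k - 1 meet the interval only in
    the obvious way, without wrapping around. *)
Lemma Zint_notin_itv k z : (k < `|z|)%N -> (`|z| + k < n)%N -> Zint z \notin itv k.
Proof.
move=> kz zk; apply/itvP=> -[w wk /eqP]; rewrite Zint_eq; apply/negP.
by rewrite gtnNdvd //; lia.
Qed.

Lemma itv_full k : (n <= 2 * k + 1)%N -> itv k = [set: 'Z_n].
Proof.
move=> nk; apply/setP=> x; rewrite inE; apply/itvP.
by have [z zn ->] := ZintP x; exists z => //; lia.
Qed.

(** A nonzero period z > 0 (say) lies in the interval, and translates k + 1 - z to
    the element k + 1 outside it. *)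
Lemma stab_itv k : (2 * k + 1 < n)%N -> stab (itv k) = 1.
Proof.
move=> kn; apply/trivgP/subsetP=> g; rewrite inE => /eqP E.
have gI : g \in itv k by rewrite -E mem_rcoset mulgV itv1.
have /itvP[z zk gz] := gI.
have shift w : (`|w| <= k)%N -> Zint (w + z)%R \in itv k.
  by move=> wk; rewrite -E ZintD -gz mem_rcoset mulgK; apply/itvP; exists w.
have [z0|z0] := eqVneq z 0%R; first by rewrite gz z0; apply: group1.
have bad w : `|w|%N = k.+1 -> Zint w \notin itv k.
  by move=> wk; apply: Zint_notin_itv; lia.
have [zp|zn] := boolP (0 <= z)%R.
  have /negP[] := bad (k.+1%:Z)%R erefl.
  by rewrite (_ : (k.+1%:Z = (k.+1%:Z - z) + z)%R) ?shift //; lia.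
have /negP[] := bad (- k.+1%:Z)%R (abszN _).
by rewrite (_ : (- k.+1%:Z = (- k.+1%:Z - z) + z)%R) ?shift //; lia.
Qed.

(** By symmetry x is the class of some X with k < X <= n / 2, and it suffices to
    reach the classes Y with 0 <= Y <= n / 2; those beyond the range h k of
    the interval are reached with j factors x and h - j in the interval. *)
Lemma itv_maximal h k (B : {set 'Z_n}) x : (0 < k)%N -> (n <= 2 * h * k.+1 + 1)%N ->
  itv k \subset B -> B^-1 = B -> x \in B -> x \notin itv k -> B ^+ h = [set: 'Z_n].
Proof.
move=> k0 nh sIB BV xB xI.
have [X Xn [XB kX]] : exists2 X : nat, (2 * X <= n)%N & Zint X%:Z \in B /\ (k < X)%N.
  have [z zn xE] := ZintP x; exists `|z|%N => //; split.
    have [z0|z0] := boolP (0 <= z)%R; first by rewrite gez0_abs // -xE.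
    by rewrite -BV mem_invg -ZintN (_ : (- `|z|%N%:Z = z)%R) -?xE //; lia.
  by rewrite ltnNge; apply: contra xI => zk; apply/itvP; exists z.
suff cover Y : (2 * Y <= n)%N -> Zint Y%:Z \in B ^+ h.
  apply/setP=> y; rewrite inE; have [z zn ->] := ZintP y.
  have [z0|z0] := boolP (0 <= z)%R; first by rewrite -(gez0_abs z0) cover.
  rewrite -[B]BV -expgS_inv mem_invg -ZintN (_ : (- z = `|z|%N%:Z)%R) ?cover //.
  by lia.
move=> Yn; have [Yk|Yk] := leqP Y (h * k).
  apply: (subsetP (expgS_mono h sIB)); rewrite itv_expgS.
  by apply/itvP; exists Y%:Z%R.
have [j jh [le1 le2]] := interval_cover k0 kX Xn Yn nh Yk.
have -> : Zint Y%:Z = Zint X%:Z ^+ j * Zint (Y%:Z - (j * X)%N%:Z)%R.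
  by rewrite -ZintX -ZintD; congr Zint; lia.
rewrite -(subnKC jh) expgnDr mem_mulg //.
  by elim: (j) => [|i IHi]; rewrite ?expg0 ?set11 // !expgS mem_mulg.
apply: (subsetP (expgS_mono _ sIB)); rewrite itv_expgS; apply/itvP.
by exists (Y%:Z - (j * X)%N%:Z)%R => //; lia.
Qed.

End Intervals.

Section CyclicGroups.
Variable n : nat.
Hypothesis n1 : 1 < n.

Lemma card_Zn : #|'Z_n| = n.
Proof. by rewrite card_ord Zp_cast. Qed.

Lemma cyclic_Zn : cyclic [set: 'Z_n].
Proof. by apply/cyclicP; exists Zp1; exact: Zp_cycle. Qed.

Lemma abelian_Zn : abelian [set: 'Z_n].
Proof. exact: cyclic_abelian cyclic_Zn. Qed.

Lemma itv_expgS_neqT h k : (2 * (h * k) + 1 < n)%N -> itv n k ^+ h != [set: 'Z_n].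
Proof.
move=> hkn; rewrite itv_expgS; apply/eqP=> /setP/(_ (Zint n (h * k).+1%:Z)).
rewrite inE; apply/negP; apply: Zint_notin_itv; lia.
Qed.

Lemma itv_rho_maximal h k : (0 < k)%N -> (2 * (h * k) + 1 < n)%N ->
  (n <= 2 * h * k.+1 + 1)%N -> rho_maximal h.+1 (itv n k).
Proof.
move=> k0 hkn nhk; apply/maxsetP; split=> [|B].
  by rewrite diam_geE (symset_id (itv_inv n k) (itv1 n k)) itv_expgS_neqT.
rewrite diam_geE => BhT sIB; apply/eqP; rewrite eqEsubset sIB andbT.
apply: contraR BhT => /subsetPn[x xB xI]; apply/eqP.
apply: (itv_maximal n1 k0 nhk _ (symset_inv B) _ xI).
  exact: subset_trans sIB (sub_symset B).
exact: (subsetP (sub_symset B)).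
Qed.

Lemma itv_full_power k : (0 < k)%N -> itv n k ^+ n = [set: 'Z_n].
Proof. by move=> k0; rewrite itv_expgS itv_full //; nia. Qed.

Lemma itv_generates k : (0 < k)%N -> generates (itv n k).
Proof.
move=> k0; rewrite /generates -subTset -(itv_full_power k0).
have /expgS_mono : itv n k \subset <<itv n k>> by exact: subset_gen.
by move=> /(_ n)/subset_trans; apply; rewrite expgS_group // ltnW.
Qed.

End CyclicGroups.

(** * The extremal values *)

Lemma Zp_reduction m d : 0 < m -> 1 < d -> d %| m ->
  exists f : {morphism [set: 'Z_m] >-> 'Z_d}, f @* [set: 'Z_m] = [set: 'Z_d].
Proof.
move=> m0 d1 dm; have m1 : 1 < m by apply: leq_trans d1 (dvdn_leq m0 dm).
have fM : {in [set: 'Z_m] &, {morph (fun x : 'Z_m => Zint d (x : nat)%:Z) : x y / x * y}}.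
  move=> x y _ _; apply/eqP; rewrite -ZintD Zint_eq //.
  have -> : nat_of_ord (x * y)%g = (((x : nat) + (y : nat)) %% m)%N.
    by congr (_ %% _)%N; exact: Zp_cast.
  move: (nat_of_ord x) (nat_of_ord y) => {}x {}y.
  have := divn_eq (x + y) m; move: ((x + y) %/ m) ((x + y) %% m) => q r E.
  case/dvdnP: dm => c cE; apply/dvdnP; exists (q * c)%N; move: E; rewrite {}cE.
  by move=> E; rewrite -mulnA; lia.
exists (Morphism fM); apply/setP=> y; rewrite [RHS]inE; apply/morphimP.
have ym : (y < m)%N.
  by apply: leq_trans (dvdn_leq m0 dm); rewrite -[X in (_ < X)%N](Zp_cast d1).
exists ((y : nat)%:R)%R; rewrite ?inE //=.
by rewrite val_Zp_nat // modn_small // /Zint -pmulrn natr_Zp.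
Qed.

Section Extremal.
Variables m h : nat.
Hypothesis h0 : 0 < h.

Definition itv_radius d := ((d - 2) %/ (2 * h))%N.

(** The two inequalities say that the h-fold sumset of the interval is proper, and
    that h steps of length k + 1 reach d / 2. *)
Lemma itv_radiusP d (k := itv_radius d) : (2 * h.+1 <= d)%N ->
  [/\ (0 < k)%N, (2 * (h * k) + 1 < d)%N & (d <= 2 * h * k.+1 + 1)%N].
Proof.
move=> hd; rewrite /k /itv_radius; have h2 : (0 < 2 * h)%N by lia.
have := divn_eq (d - 2) (2 * h); have := ltn_pmod (d - 2) h2.
have : (0 < (d - 2) %/ (2 * h))%N by rewrite divn_gt0 //; lia.
move: ((d - 2) %/ _)%N ((d - 2) %% _)%N => q r q0 rh E.
split => //; nia.
Qed.

Lemma t_Zn : (2 * h.+1 <= m)%N ->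
  t_ h.+1 'Z_m = (2 * itv_radius m + 1)%N.
Proof.
move=> hm; have m1 : (1 < m)%N by lia.
have [k0 hkm mhk] := itv_radiusP hm; set k := itv_radius m in k0 hkm mhk *.
have km : (2 * k + 1 < m)%N by nia.
apply/eqP; rewrite eqn_leq; apply/andP; split.
  apply/bigmax_leqP => A /and3P[aA /rho_maximal_sym maxA _].
  have := card_sym_maximal (abelian_Zn m) h0 maxA _ _; rewrite card_Zn //; apply.
    by rewrite -period_stab; apply/eqP.
  by move=> x y; apply: cyclic_involution_uniq (cyclic_Zn m).
rewrite addn1 -(card_itv m1); last by lia.
apply: (@leq_bigmax_cond _ _ (fun A : {set 'Z_m} => #|A|)).
rewrite /aperiodic period_stab stab_itv // eqxx itv_rho_maximal //.
exact: itv_generates.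
Qed.

(** Taking preimages in Z_m commutes with powers, so the preimage of the extremal
    interval of Z_d keeps its diameter and has m / d times as many elements. *)
Lemma s_Zn_lower d : 0 < m -> d %| m -> (2 * h.+1 <= d)%N ->
  (m %/ d * (2 * itv_radius d + 1) <= s_ h.+1 'Z_m)%N.
Proof.
move=> m0 dm hd; have d1 : (1 < d)%N by lia.
have m1 : (1 < m)%N by apply: leq_trans d1 (dvdn_leq m0 dm).
have [k0 hkd dhk] := itv_radiusP hd; set k := itv_radius d in k0 hkd dhk *.
have [f fT] := Zp_reduction m0 d1 dm.
have DT : [set: 'Z_m]%G = [set: 'Z_m] :> {set 'Z_m} by [].
pose A := f @*^-1 (itv d k).
have symA : symset A = A.
  apply: symset_id; first by rewrite -morphpreV itv_inv.
  by apply/morphpreP; rewrite inE morph1 itv1.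
have cA : #|A| = (m %/ d * (2 * k + 1))%N.
  rewrite card_morphpre_set // card_itv //; last by nia.
  have := card_morphpre_set DT fT [set: 'Z_d].
  have -> : f @*^-1 [set: 'Z_d] = [set: 'Z_m].
    by apply/eqP; rewrite (morphpre_eqT DT fT).
  rewrite !cardsT !card_Zn // => /(congr1 (divn^~ d)); rewrite mulnK; last by lia.
  by move=> <-; rewrite addn1.
rewrite -cA; apply: (@leq_bigmax_cond _ _ (fun A : {set 'Z_m} => #|A|)).
rewrite diam_geE symA -(morphpre_expgS fT) // (morphpre_eqT DT fT) itv_expgS_neqT //=.
apply/diam_finiteP; exists d; rewrite symA -(morphpre_expgS fT); last by lia.
by apply/eqP; rewrite (morphpre_eqT DT fT) itv_full_power.
Qed.

(** Extend the set to a maximal one, A, and divide by the stabilizer P of A.  If the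
    quotient had order d < 2 rho, the upper bound would leave a single point as
    image of A, so A would be a subgroup, and equal to the whole group because
    its diameter is finite, which maximality excludes. *)
Lemma s_Zn_upper : 0 < m -> (2 * h.+1 <= m)%N ->
  (s_ h.+1 'Z_m <= \max_(d <- divisors m | (2 * h.+1 <= d)%N) m %/ d * (2 * itv_radius d + 1))%N.
Proof.
move=> m0 hm; have m1 : (1 < m)%N by lia.
apply/bigmax_leqP => A0 /andP[geA0 /diam_finiteP[r rT]].
have [A maxA sA] := maxset_exists geA0.
have symA := rho_maximal_sym maxA; have [AV A1 AhT _] := symA.
apply: leq_trans (subset_leq_card sA) _.
have ArT : A ^+ r = [set: 'Z_m].
  have sAV : A0^-1 \subset A by rewrite -AV invSg.
  by apply/eqP; rewrite -subTset -rT expgS_mono // symsetE !subUset sAV sub1set A1.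
pose P := stab_group A; pose f := coset_morphism P.
have cZ := abelian_Zn m.
have DT : 'N(P) = [set: 'Z_m] :> {set 'Z_m}.
  apply/eqP; rewrite -subTset cents_norm //.
  by apply: sub_abelian_cent2 cZ _ _; exact: subsetT.
have fT : f @* 'N(P) = [set: coset_of P].
  by apply/eqP; rewrite -subTset -quotientT quotientE morphimS ?DT.
have kerE : 'ker f = stab A by rewrite ker_coset.
have [maxB stabB cA] := sym_maximal_morphim cZ DT fT h0 symA kerE.
set d := #|{: coset_of P}|.
have mPd : (m = #|P| * d)%N.
  rewrite /d -cardsT -quotientT card_quotient ?DT ?subsetT // Lagrange ?subsetT //.
  by rewrite cardsT card_Zn.
have cycQ : cyclic [set: coset_of P].
  by rewrite -quotientT quotient_cyclic // cyclic_Zn.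
have cB : (#|f @* A| <= 2 * itv_radius d + 1)%N.
  have := card_sym_maximal (cyclic_abelian cycQ) h0 maxB stabB; apply=> x y.
  exact: cyclic_involution_uniq.
have P0 : 0 < #|P| by exact: cardG_gt0.
have hd : (2 * h.+1 <= d)%N.
  rewrite leqNgt; apply/negP => dh.
  have kd0 : itv_radius d = 0%N by rewrite /itv_radius divn_small //; lia.
  have B1 : f @* A = 1.
    apply/eqP; rewrite eq_sym eqEcard cards1 sub1set; have [_ -> _ _] := maxB.
    by move: cB; rewrite kd0.
  have sAD : A \subset 'N(P) by rewrite DT subsetT.
  have sAP : A \subset P.
    by have := ker_trivg_morphim f A; rewrite sAD B1 subxx kerE => ->.
  have PT : (P : {set 'Z_m}) = [set: 'Z_m].
    apply/eqP; rewrite -subTset -ArT; apply: subset_trans (expgS_mono r sAP) _.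
    by case: (r) => [|r']; [rewrite expg0 sub1G | rewrite expgS_group].
  have AT : A = [set: 'Z_m].
    by apply/eqP; rewrite -subTset -PT -(mulg_stab A) mulg_subr.
  by case/eqP: AhT; rewrite AT expgS_group.
have dE : (m %/ d)%N = #|P|.
  by have := congr1 (divn^~ d) mPd; rewrite mulnK //; lia.
apply: leq_trans (_ : (m %/ d * (2 * itv_radius d + 1) <= _)%N).
  by rewrite cA kerE -/(gval P) dE leq_mul2l cB orbT.
have dm : d \in divisors m by rewrite -dvdn_divisors //; apply/dvdnP; exists #|P|.
exact: bigmax_sup_seq dm hd (leqnn _).
Qed.

End Extremal.

Theorem theorem2p9 (m rho : nat) (hm : (0 < m)%N)
    (hrho : (2 <= rho)%N) (hrhom : (2 * rho <= m)%N) :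
  t_ rho 'Z_m = (2 * ((m - 2) %/ (2 * (rho - 1))) + 1)%N /\
  s_ rho 'Z_m =
    (\max_(d <- divisors m | 2 * rho <= d)
       (m %/ d) * (2 * ((d - 2) %/ (2 * (rho - 1))) + 1))%N.
Proof.
case: rho hrho hrhom => // h h1 hhm; rewrite subSS subn0.
split; first exact: t_Zn.
apply/eqP; rewrite eqn_leq; apply/andP; split; first exact: s_Zn_upper.
apply/bigmax_leqP_seq => d; rewrite -dvdn_divisors // => dm hd.
exact: s_Zn_lower.
Qed.
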